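(* Let $1 \leq p < \infty$, let $X$ be a Banach space and let $F$ be a Banach lattice. The following are equivalent for a linear operator $T \colon X \rightarrow F$: (a) $T^{*}\colon F^{*}\rightarrow X^{*}$ is disjoint $p$-convergent. (b) $q_{T^{*}}(y_{n}^{*})\longrightarrow 0$ for every disjoint weakly $p$-summable sequence $(y_{n}^{*})_n$ in $F^{*}$. (c) $q_{T^{*}}(y_{n}^{*})\longrightarrow 0$ for every positive disjoint weakly $p$-summable sequence $(y_{n}^{*})_n$ in $F^{*}$. (d) $y_{n}^{*}(T(x_{n}))\longrightarrow 0$ for every disjoint weakly $p$-summable sequence $(y_{n}^{*})_n$ in $F^{*}$ and every bounded sequence $(x_{n})_n$ in $X$. (e) $y_{n}^{*}(T(x_{n}))\longrightarrow 0$ for every positive disjoint weakly $p$-summable sequence $(y_{n}^{*})_n$ in $F^{*}$ and every bounded sequence $(x_{n})_n$ in $X$. (f) For every Banach lattice $G$ and every linear operator $S\colon G\rightarrow X$, $S^{*}T^{*}\colon F^{*}\rightarrow G^{*}$ is a disjoint $p$-convergent operator. (g) For every linear operator $S \colon \ell_{1}\rightarrow X$, $S^{*}T^{*}\colon F^{*}\rightarrow \ell_{1}^{*}$ is a disjoint $p$-convergent operator.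
   Context: All linear operators are assumed bounded; $T^*$ denotes the adjoint of $T$. A sequence $(x_n)_n$ in a Banach lattice is disjoint if $|x_n|\wedge|x_m|=0$ for $n\neq m$. A sequence $(x_n)_n$ in a Banach space $Z$ is weakly $p$-summable if $(x^*(x_n))_n \in \ell_p$ for every $x^* \in Z^*$. A linear operator from a Banach lattice to a Banach space is disjoint $p$-convergent if it sends disjoint weakly $p$-summable sequences to norm null sequences. For a linear operator $R\colon H\to Y$ from a Banach lattice $H$ to a Banach space $Y$, $q_R$ is the lattice seminorm on $H$ given by $q_R(x)=\sup\{\|R(y)\| : |y|\leq |x|\}$, $x \in H$; here it is applied to $R=T^*$, $H=F^*$. *)

(* Defs.v *)
From HB Require Import structures.
From mathcomp Require Import all_boot all_order all_algebra.
From mathcomp Require Import all_classical all_reals all_analysis.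
From mathcomp Require Import ring lra.

Set Implicit Arguments.
Unset Strict Implicit.
Unset Printing Implicit Defensive.

Import Order.TTheory GRing.Theory Num.Theory.
Import numFieldNormedType.Exports.

Local Open Scope classical_set_scope.
Local Open Scope ring_scope.

Record bounded_op (R : realType) (V W : normedModType R) := BoundedOp {
  bounded_op_val :> {linear V -> W} ;
  bounded_opP : bounded_near bounded_op_val (nbhs (0 : V)) }.

Section bounded_op_theory.
Context {R : realType} {V W : normedModType R}.
Implicit Types f g : bounded_op V W.

HB.instance Definition _ := gen_eqMixin (bounded_op V W).
HB.instance Definition _ := gen_choiceMixin (bounded_op V W).

Lemma bounded_op_ext f g : f =1 g -> f = g.
Proof.
case: f g => [f fb] [g gb] /= /funext fg.
suff fg' : f = g by subst g; congr BoundedOp; exact: Prop_irrelevance.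
case: f g fg {fb gb} => [f [[fD] [fZ]]] [g [[gD] [gZ]]] /= fg; subst g.
have -> : fD = gD by exact: Prop_irrelevance.
by have -> : fZ = gZ by exact: Prop_irrelevance.
Qed.

Lemma bounded_opW f : exists2 M, 0 < M & forall x, `|f x| <= M * `|x|.
Proof. by have /linear_boundedP/pinfty_ex_gt0[M M0 fM] := bounded_opP f; exists M. Qed.

Lemma bounded_near_linear (f : {linear V -> W}) (M : R) :
  (forall x, `|f x| <= M * `|x|) -> bounded_near f (nbhs (0 : V)).
Proof.
move=> fM; apply/linear_boundedP; near=> r => x.
by rewrite (le_trans (fM x))// ler_wpM2r.
Unshelve. all: by end_near. Qed.

Lemma bounded_op0_subproof : bounded_near (\0 : {linear V -> W}) (nbhs (0 : V)).
Proof. by apply: (@bounded_near_linear _ 0) => x; rewrite normr0 mul0r. Qed.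

Lemma bounded_opD_subproof f g :
  bounded_near (f \+ g : {linear V -> W}) (nbhs (0 : V)).
Proof.
have [M _ fM] := bounded_opW f; have [N _ gN] := bounded_opW g.
apply: (@bounded_near_linear _ (M + N)) => x /=.
by rewrite mulrDl (le_trans (ler_normD _ _))// lerD.
Qed.

Lemma bounded_opZ_subproof (a : R) f :
  bounded_near (a \*: f : {linear V -> W}) (nbhs (0 : V)).
Proof.
have [M _ fM] := bounded_opW f.
apply: (@bounded_near_linear _ (`|a| * M)) => x /=.
by rewrite normrZ -mulrA ler_wpM2l.
Qed.

Lemma bounded_opN_subproof f :
  bounded_near (\- f : {linear V -> W}) (nbhs (0 : V)).
Proof.
have [M _ fM] := bounded_opW f.
by apply: (@bounded_near_linear _ M) => x /=; rewrite normrN.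
Qed.

Let add f g := BoundedOp (bounded_opD_subproof f g).
Let zero := BoundedOp bounded_op0_subproof.
Let opp f := BoundedOp (bounded_opN_subproof f).
Let scale a f := BoundedOp (bounded_opZ_subproof a f).

Let addA : associative add.
Proof. by move=> f g h; apply: bounded_op_ext => x /=; rewrite addrA. Qed.
Let addC : commutative add.
Proof. by move=> f g; apply: bounded_op_ext => x /=; rewrite addrC. Qed.
Let add0 : left_id zero add.
Proof. by move=> f; apply: bounded_op_ext => x /=; rewrite add0r. Qed.
Let addN : left_inverse zero opp add.
Proof. by move=> f; apply: bounded_op_ext => x /=; rewrite addNr. Qed.

HB.instance Definition _ :=
  GRing.isZmodule.Build (bounded_op V W) addA addC add0 addN.

Let scaleA a b f : scale a (scale b f) = scale (a * b) f.
Proof. by apply: bounded_op_ext => x /=; rewrite scalerA. Qed.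
Let scale1 : left_id 1 scale.
Proof. by move=> f; apply: bounded_op_ext => x /=; rewrite scale1r. Qed.
Let scaleDr : right_distributive scale +%R.
Proof. by move=> a f g; apply: bounded_op_ext => x /=; rewrite scalerDr. Qed.
Let scaleDl f : {morph scale^~ f : a b / a + b}.
Proof. by move=> a b; apply: bounded_op_ext => x /=; rewrite scalerDl. Qed.

HB.instance Definition _ := GRing.Zmodule_isLmodule.Build R (bounded_op V W)
  scaleA scale1 scaleDr scaleDl.

Lemma bopDE f g x : (f + g) x = f x + g x. Proof. by []. Qed.
Lemma bop0E x : (0 : bounded_op V W) x = 0. Proof. by []. Qed.
Lemma bopNE f x : (- f) x = - f x. Proof. by []. Qed.
Lemma bopBE f g x : (f - g) x = f x - g x. Proof. by []. Qed.
Lemma bopZE a f x : (a *: f) x = a *: f x. Proof. by []. Qed.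

(* The real [sup] is meaningful: the set is nonempty and bounded. *)
Definition op_norm f : R := sup [set `|f x| | x in [set x : V | `|x| <= 1]].

Let op_norm_has_sup f : has_sup [set `|f x| | x in [set x : V | `|x| <= 1]].
Proof.
split; first by exists `|f 0|, 0 => //=; rewrite normr0.
have [M M0 fM] := bounded_opW f; exists M => _ [x /= x1 <-].
by rewrite (le_trans (fM x))// -[leRHS]mulr1 ler_wpM2l// ltW.
Qed.

Lemma op_norm_ge0 f : 0 <= op_norm f.
Proof.
apply: (le_trans (normr_ge0 (f 0))); apply: ub_le_sup.
  by have [] := op_norm_has_sup f.
by exists 0 => //=; rewrite normr0.
Qed.

Lemma op_normP f x : `|f x| <= op_norm f * `|x|.
Proof.
have [->|x0] := eqVneq x 0; first by rewrite linear0 !normr0 mulr0.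
have nx0 : 0 < `|x| by rewrite normr_gt0.
rewrite -ler_pdivrMr//.
have -> : `|f x| / `|x| = `|f (`|x|^-1 *: x)|.
  by rewrite linearZ normrZ gtr0_norm ?invr_gt0// mulrC.
apply: ub_le_sup; first by have [] := op_norm_has_sup f.
exists (`|x|^-1 *: x) => //=.
by rewrite normrZ gtr0_norm ?invr_gt0// mulVf// gt_eqF.
Qed.

Lemma op_norm_le f M : 0 <= M -> (forall x, `|f x| <= M * `|x|) -> op_norm f <= M.
Proof.
move=> M0 fM; apply: ge_sup; first by have [] := op_norm_has_sup f.
move=> _ [x /= x1 <-]; rewrite (le_trans (fM x))//.
by rewrite -[leRHS]mulr1 ler_wpM2l.
Qed.

Let op_normD f g : op_norm (f + g) <= op_norm f + op_norm g.
Proof.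
apply: op_norm_le => [|x]; first by rewrite addr_ge0 ?op_norm_ge0.
by rewrite mulrDl (le_trans (ler_normD _ _))// lerD ?op_normP.
Qed.

Let op_normZ a f : op_norm (a *: f) = `|a| * op_norm f.
Proof.
have le b g : op_norm (b *: g) <= `|b| * op_norm g.
  apply: op_norm_le => [|x]; first by rewrite mulr_ge0 ?op_norm_ge0.
  by rewrite bopZE normrZ -mulrA ler_wpM2l// op_normP.
apply/eqP; rewrite eq_le le /=.
have [->|a0] := eqVneq a 0; first by rewrite normr0 mul0r op_norm_ge0.
rewrite -ler_pdivlMl ?normr_gt0// -normfV.
by rewrite -{1}[f](scalerK a0) le.
Qed.

Let op_norm_eq0 f : op_norm f = 0 -> f = 0.
Proof.
move=> f0; apply: bounded_op_ext => x; apply/eqP; rewrite -normr_le0.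
by have := op_normP f x; rewrite f0 mul0r.
Qed.

HB.instance Definition _ := Lmodule_isNormed.Build R (bounded_op V W)
  op_normD op_normZ op_norm_eq0.

Lemma op_normE f : `|f| = op_norm f. Proof. by []. Qed.

Lemma op_normr f x : `|f x| <= `|f| * `|x|.
Proof. exact: op_normP. Qed.

End bounded_op_theory.


Section bounded_op_complete.
Context {R : realType} {V : normedModType R} {W : completeNormedModType R}.

Let bounded_op_cauchy (F : set_system (bounded_op V W)) :
  ProperFilter F -> cauchy F -> cvg F.
Proof.
move=> FF /cauchy_ballP Fc.
have Fe e : 0 < e -> exists A B : set (bounded_op V W),
    [/\ F A, F B & forall f g, A f -> B g -> `|f - g| < e].
  move=> /Fc[[A B] [FA FB] AB]; exists A, B; split => // f g Af Bg.
  by have := AB (f, g); rewrite -ball_normE/=; apply; split.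
have Fx x : cvg ((fun f : bounded_op V W => f x) @ F).
  apply/cauchy_cvgP/cauchy_ballP => e e0.
  have d0 : 0 < e / (`|x| + 1) by rewrite divr_gt0// ltr_wpDl.
  have [A [B [FA FB AB]]] := Fe _ d0.
  exists ((fun f : bounded_op V W => f x) @` A,
          (fun f : bounded_op V W => f x) @` B).
    by split; [apply: (@filterS _ F _ A)|apply: (@filterS _ F _ B)] => // f;
      exists f.
  move=> [_ _] [/= [f Af <-] [g Bg <-]]; rewrite -ball_normE/=.
  rewrite -bopBE (le_lt_trans (op_normr _ _))//.
  rewrite (@le_lt_trans _ _ (`|f - g| * (`|x| + 1)))//.
    by rewrite ler_wpM2l// lerDl.
  by rewrite -ltr_pdivlMr ?AB// ltr_wpDl.
pose L x := lim ((fun f : bounded_op V W => f x) @ F).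
have LP x : (fun f : bounded_op V W => f x) @ F --> L x by exact: Fx.
have Llin : linear L.
  move=> a x y; apply: (cvg_lim (@norm_hausdorff _ _)).
  have -> : (fun f : bounded_op V W => f (a *: x + y)) =
            (fun f => a *: f x + f y).
    by apply/funext => f; rewrite linearP.
  by apply: cvgD => //; exact: cvgZl_tmp.
pose Lm := GRing.isLinear.Build R V W _ L Llin.
pose Ll : {linear V -> W} := HB.pack L Lm.
have LF e : 0 < e ->
    \forall f \near F, forall x, `|(f : bounded_op V W) x - L x| <= e * `|x|.
  move=> /Fe[A [B [FA FB AB]]]; apply: filterS FA => f Af x.
  apply/ler_addgt0Pr => d d0.
  have /cvgrPdist_lt/(_ _ d0) FL := LP x.
  have [g [Bg gL]] := @filter_ex _ _ FF _ (filterI FB FL).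
  rewrite -(subrKA (g x)) (le_trans (ler_normD _ _))// lerD//.
    rewrite -bopBE (le_trans (op_normr _ _))// ler_wpM2r//.
    by rewrite ltW// AB.
  by rewrite distrC ltW.
have Lb : bounded_near Ll (nbhs (0 : V)).
  have [f fL] := @filter_ex _ _ FF _ (LF _ ltr01).
  apply: (@bounded_near_linear _ _ _ _ (`|f| + 1)) => x /=.
  rewrite -[L x](subKr (f x)) (le_trans (ler_normB _ _))// mulrDl lerD//.
  exact: op_normr.
apply/cvg_ex; exists (BoundedOp Lb); apply/cvgrPdist_le => e e0.
apply: filterS (LF _ e0) => f fL; rewrite op_normE.
apply: op_norm_le => [|x]; first exact: ltW.
by rewrite bopBE /= distrC.
Qed.

HB.instance Definition _ :=
  Uniform_isComplete.Build (bounded_op V W) bounded_op_cauchy.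

End bounded_op_complete.

Definition dual (R : realType) (V : normedModType R) : Type := bounded_op V R.

HB.instance Definition _ (R : realType) (V : normedModType R) :=
  CompleteNormedModule.copy (dual V) (bounded_op V R).

Section composition.
Context {R : realType} {U V W : normedModType R}.

Lemma bounded_comp_subproof (g : bounded_op V W) (f : bounded_op U V) :
  bounded_near (g \o f : {linear U -> W}) (nbhs (0 : U)).
Proof.
apply: (@bounded_near_linear _ _ _ _ (`|g| * `|f|)) => x /=.
by rewrite (le_trans (op_normr _ _))// -mulrA ler_wpM2l// op_normr.
Qed.

Definition bounded_comp (g : bounded_op V W) (f : bounded_op U V) :
  bounded_op U W := BoundedOp (bounded_comp_subproof g f).

End composition.

Section adjoint.
Context {R : realType} {V W : normedModType R} (T : bounded_op V W).

Definition adjoint_fun (g : dual W) : dual V := bounded_comp g T.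

Lemma adjoint_linear : linear adjoint_fun.
Proof. by move=> a f g; apply: bounded_op_ext => x. Qed.

HB.instance Definition _ :=
  GRing.isLinear.Build R (dual W) (dual V) _ adjoint_fun adjoint_linear.

Lemma adjoint_bounded : bounded_near adjoint_fun (nbhs (0 : dual W)).
Proof.
apply: (@bounded_near_linear _ _ _ _ `|T|) => g.
rewrite mulrC; apply: op_norm_le => [|x]; first by rewrite mulr_ge0.
by rewrite (le_trans (op_normr g (T x)))// -mulrA ler_wpM2l ?op_normr.
Qed.

Definition adjoint : bounded_op (dual W) (dual V) := BoundedOp adjoint_bounded.

Lemma adjointE (g : dual W) (v : V) : adjoint g v = g (T v). Proof. by []. Qed.

End adjoint.

(* The order is a separate relation [vle]: the hierarchy admits no join of the
   library's order structures with normed modules, because [numDomainType]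
   already inherits from ordered and from normed Z-modules. *)
HB.mixin Record isBanachLattice (R : realType) E
    & CompleteNormedModule R E := {
  vle : E -> E -> Prop ;
  vsup : E -> E -> E ;
  vinf : E -> E -> E ;
  vle_refl : forall x, vle x x ;
  vle_anti : forall x y, vle x y -> vle y x -> x = y ;
  vle_trans : forall y x z, vle x y -> vle y z -> vle x z ;
  vsupP : forall x y z, vle (vsup x y) z <-> vle x z /\ vle y z ;
  vinfP : forall x y z, vle z (vinf x y) <-> vle z x /\ vle z y ;
  vle_add : forall z x y, vle x y -> vle (x + z) (y + z) ;
  vle_scale : forall (a : R) x y, 0 <= a -> vle x y -> vle (a *: x) (a *: y) ;
  vle_norm : forall x y, vle (vsup x (- x)) (vsup y (- y)) -> `|x| <= `|y| }.

#[short(type="banachLatticeType")]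
HB.structure Definition BanachLattice (R : realType) :=
  {E of isBanachLattice R E & CompleteNormedModule R E}.

Arguments vle_anti {R s} [x y].
Arguments vle_trans {R s} y [x z].
Arguments vsupP {R s x y z}.
Arguments vinfP {R s x y z}.
Arguments vle_add {R s} z [x y].
Arguments vle_scale {R s} [a x y].
Arguments vle_norm {R s} [x y].

Section banach_lattice_theory.
Context {R : realType} {E : banachLatticeType R}.
Implicit Types x y z : E.

Definition vabs x : E := vsup x (- x).

Lemma vle_supl x y : vle x (vsup x y).
Proof. by have /vsupP[] := vle_refl (vsup x y). Qed.
Lemma vle_supr x y : vle y (vsup x y).
Proof. by have /vsupP[] := vle_refl (vsup x y). Qed.
Lemma vle_infl x y : vle (vinf x y) x.
Proof. by have /vinfP[] := vle_refl (vinf x y). Qed.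
Lemma vle_infr x y : vle (vinf x y) y.
Proof. by have /vinfP[] := vle_refl (vinf x y). Qed.

Lemma vle_subr0 x y : vle 0 (y - x) <-> vle x y.
Proof.
split => [/(vle_add x)|/(vle_add (- x))]; first by rewrite add0r subrK.
by rewrite subrr.
Qed.

Lemma vle_addr0 x y : vle 0 x -> vle 0 y -> vle 0 (x + y).
Proof.
move=> x0 y0; apply: (vle_trans y) => //.
by have := vle_add y x0; rewrite add0r.
Qed.

Lemma vle_scale0 (a : R) x : 0 <= a -> vle 0 x -> vle 0 (a *: x).
Proof. by move=> a0 /(vle_scale a0); rewrite scaler0. Qed.

Lemma vle_abs x : vle x (vabs x). Proof. exact: vle_supl. Qed.
Lemma vle_absN x : vle (- x) (vabs x). Proof. exact: vle_supr. Qed.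

Lemma vabs_ge0 x : vle 0 (vabs x).
Proof.
have : vle 0 (2%:R *: vabs x).
  rewrite scaler_nat mulr2n -[X in vle X _](subrr x).
  apply: (vle_trans (vabs x - x)); first exact/vle_add/vle_abs.
  by rewrite ![vabs x + _]addrC; exact/vle_add/vle_absN.
move/(@vle_scale0 2%:R^-1); rewrite scalerA mulVf ?pnatr_eq0// scale1r.
by apply; rewrite invr_ge0.
Qed.

Lemma vabs_le x y : vle (vabs x) y <-> vle x y /\ vle (- x) y.
Proof. exact: vsupP. Qed.

Lemma vabs_id x : vle 0 x -> vabs x = x.
Proof.
move=> x0; apply: vle_anti; last exact: vle_abs.
apply/vabs_le; split; first exact: vle_refl.
apply: (vle_trans 0) => //.
by have := vle_add (- x) x0; rewrite add0r subrr.
Qed.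

Lemma vabs_normE x : `|vabs x| = `|x|.
Proof.
by apply/eqP; rewrite eq_le; apply/andP; split; apply: vle_norm;
  rewrite -![vsup _ _]/(vabs _) (vabs_id (vabs_ge0 x)); exact: vle_refl.
Qed.

Lemma vle_norm_ge0 x y : vle 0 x -> vle x y -> `|x| <= `|y|.
Proof.
move=> x0 xy; apply: vle_norm; rewrite -![vsup _ _]/(vabs _).
by rewrite !vabs_id//; apply: vle_trans xy.
Qed.

Lemma vle_abs_norm x y : vle (vabs x) y -> `|x| <= `|y|.
Proof. by move=> xy; rewrite -vabs_normE vle_norm_ge0//; exact: vabs_ge0. Qed.

Lemma vdecomp x : exists a b, [/\ vle 0 a, vle 0 b & x = a - b].
Proof.
exists (vsup x 0), (vsup x 0 - x); split; first exact: vle_supr.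
  by apply/vle_subr0; exact: vle_supl.
by rewrite subKr.
Qed.

Lemma riesz_decomp a b y : vle 0 a -> vle 0 b -> vle 0 y -> vle y (a + b) ->
  exists y1 y2, [/\ y = y1 + y2, vle 0 y1, vle y1 a, vle 0 y2 & vle y2 b].
Proof.
move=> a0 b0 y0 yab; exists (vinf y a), (y - vinf y a).
split; rewrite ?[_ + (y - _)]addrC ?subrK//.
- exact/vinfP.
- exact: vle_infr.
- by apply/vle_subr0; exact: vle_infl.
- have : vle (y - b) (vinf y a).
    apply/vinfP; split; apply/vle_subr0; first by rewrite subKr.
    by rewrite opprB addrA; exact/vle_subr0.
  move/vle_subr0; rewrite opprB addrA => h; apply/vle_subr0.
  by rewrite opprB addrCA addrA.
Qed.

End banach_lattice_theory.

Section dual_lattice.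
Context {R : realType} {F : banachLatticeType R}.
Implicit Types (f g h : dual F) (x y : F).

Definition dual_le f g : Prop := forall x, vle 0 x -> (f x : R) <= g x.

(* Riesz-Kantorovich formula for the positive part on the positive cone *)
Let pos_set f x : set R := [set (f y : R) | y in [set y | vle 0 y /\ vle y x]].
Let pos_cone f x : R := sup (pos_set f x).

Let dual_op_normr f x : `|(f x : R)| <= `|f| * `|x|.
Proof. exact: op_normr. Qed.

Let pos_has_sup f x : vle 0 x -> has_sup (pos_set f x).
Proof.
move=> x0; split; first by exists (f 0), 0 => //=; split; [exact: vle_refl|].
exists (`|f| * `|x|) => _ [y [y0 yx] <-].
rewrite (le_trans (ler_norm _))// (le_trans (dual_op_normr _ _))//.
by rewrite ler_wpM2l// vle_norm_ge0.
Qed.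

Let pos_ub f x y : vle 0 y -> vle y x -> (f y : R) <= pos_cone f x.
Proof.
move=> y0 yx; apply: ub_le_sup; last by exists y.
by have [] := pos_has_sup f (vle_trans y y0 yx).
Qed.

Let pos_lub f x M : vle 0 x ->
  (forall y, vle 0 y -> vle y x -> (f y : R) <= M) -> pos_cone f x <= M.
Proof.
move=> x0 fM; apply: ge_sup; first by have [] := pos_has_sup f x0.
by move=> _ [y [y0 yx] <-]; exact: fM.
Qed.

Let pos_cone_ge0 f x : vle 0 x -> 0 <= pos_cone f x.
Proof.
by move=> x0; rewrite -(linear0 f); apply: pos_ub => //; exact: vle_refl.
Qed.

Let pos_cone_norm f x : vle 0 x -> pos_cone f x <= `|f| * `|x|.
Proof.
move=> x0; apply: pos_lub => // y y0 yx.
rewrite (le_trans (ler_norm _))// (le_trans (dual_op_normr _ _))//.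
by rewrite ler_wpM2l// vle_norm_ge0.
Qed.

Let pos_coneD f x y : vle 0 x -> vle 0 y ->
  pos_cone f (x + y) = pos_cone f x + pos_cone f y.
Proof.
move=> x0 y0; apply/eqP; rewrite eq_le; apply/andP; split.
  apply: pos_lub => [|z z0 zxy]; first exact: vle_addr0.
  have [z1 [z2 [-> z10 z1x z20 z2y]]] := riesz_decomp x0 y0 z0 zxy.
  by rewrite linearD lerD// pos_ub.
rewrite -lerBrDr; apply: pos_lub => // z z0 zx.
rewrite lerBrDr addrC -lerBrDr; apply: pos_lub => // t t0 ty.
rewrite lerBrDr -linearD; apply: pos_ub; first exact: vle_addr0.
apply: (vle_trans (t + x)); last by rewrite [x + y]addrC; exact: vle_add.
by rewrite ![t + _]addrC; exact: vle_add.
Qed.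

Let pos_coneZ f (a : R) x : 0 <= a -> vle 0 x ->
  pos_cone f (a *: x) = a * pos_cone f x.
Proof.
have le b z : 0 < b -> vle 0 z -> pos_cone f (b *: z) <= b * pos_cone f z.
  move=> b0 z0; apply: pos_lub => [|t t0 tz].
    by apply: vle_scale0 => //; exact: ltW.
  rewrite -ler_pdivrMl//; have -> : b^-1 * (f t : R) = f (b^-1 *: t).
    by rewrite linearZ.
  apply: pos_ub; first by apply: vle_scale0; rewrite ?invr_ge0// ltW.
  rewrite -[z]scale1r -(@mulVf _ b) ?gt_eqF// -scalerA.
  by apply: vle_scale; rewrite ?invr_ge0// ltW.
rewrite le_eqVlt => /predU1P[<- x0|a0 x0].
  rewrite scale0r mul0r; apply/eqP; rewrite eq_le pos_cone_ge0 ?andbT; last first.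
    exact: vle_refl.
  by rewrite (le_trans (pos_cone_norm _ (vle_refl 0)))// normr0 mulr0.
apply/eqP; rewrite eq_le le//=.
rewrite -ler_pdivlMl// -{1}[x](scalerK (lt0r_neq0 a0)).
by apply: le; rewrite ?invr_gt0//; apply: vle_scale0 => //; exact: ltW.
Qed.

Let pos_fun f x : R := pos_cone f (vsup x 0) - pos_cone f (vsup x 0 - x).

Let pos_funE f a b : vle 0 a -> vle 0 b ->
  pos_fun f (a - b) = pos_cone f a - pos_cone f b.
Proof.
move=> a0 b0; set x := a - b; set p := vsup x 0.
have p0 : vle 0 p by exact: vle_supr.
have px : vle 0 (p - x) by apply/vle_subr0; exact: vle_supl.
have : pos_cone f p + pos_cone f b = pos_cone f a + pos_cone f (p - x).
  by rewrite -!pos_coneD//; congr pos_cone; rewrite /x opprB addrCA subrKC.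
rewrite /pos_fun -/p; lra.
Qed.

Let pos_fun_linear f : linear (pos_fun f : F -> R).
Proof.
have D x y : pos_fun f (x + y) = pos_fun f x + pos_fun f y.
  have [a [b [a0 b0 ->]]] := vdecomp x; have [c [d [c0 d0 ->]]] := vdecomp y.
  have -> : a - b + (c - d) = (a + c) - (b + d) by rewrite opprD addrACA.
  by rewrite !pos_funE ?pos_coneD; [lra|try exact: vle_addr0..].
have Z (c : R) x : 0 <= c -> pos_fun f (c *: x) = c * pos_fun f x.
  move=> c0; have [a [b [a0 b0 ->]]] := vdecomp x.
  rewrite scalerBr !pos_funE ?pos_coneZ//; [lra|exact: vle_scale0..].
have N x : pos_fun f (- x) = - pos_fun f x.
  have [a [b [a0 b0 ->]]] := vdecomp x.
  by rewrite opprB !pos_funE// opprB.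
move=> c x y; rewrite D; congr +%R; have [c0|c0] := leP 0 c; first exact: Z.
have := Z (- c) x; rewrite oppr_ge0 => /(_ (ltW c0)).
by rewrite scaleNr N mulNr => /oppr_inj.
Qed.

HB.instance Definition _ f :=
  GRing.isLinear.Build R F R _ (pos_fun f) (pos_fun_linear f).

Let pos_fun_bounded f : bounded_near (pos_fun f : {linear F -> R}) (nbhs (0 : F)).
Proof.
apply: (@bounded_near_linear _ _ _ _ (3 * `|f|)) => x /=.
have p0 : vle 0 (vsup x 0) by exact: vle_supr.
have px : `|vsup x 0| <= `|x|.
  rewrite -(vabs_normE x); apply: vle_norm_ge0 => //.
  by apply/vsupP; split; [exact: vle_abs|exact: vabs_ge0].
have n0 : vle 0 (vsup x 0 - x) by apply/vle_subr0; exact: vle_supl.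
have nx : `|vsup x 0 - x| <= 2 * `|x|.
  by rewrite (le_trans (ler_normB _ _))//; lra.
rewrite /pos_fun (le_trans (ler_normB _ _))//.
rewrite !ger0_norm ?pos_cone_ge0//.
have := pos_cone_norm f p0; have := pos_cone_norm f n0.
have := ler_wpM2l (normr_ge0 f) px; have := ler_wpM2l (normr_ge0 f) nx.
lra.
Qed.

Definition dual_pos f : dual F := BoundedOp (pos_fun_bounded f).

Let dual_posE f x : vle 0 x -> dual_pos f x = pos_cone f x :> R.
Proof.
move=> x0; rewrite -[x]subr0 /= pos_funE//; last exact: vle_refl.
suff -> : pos_cone f 0 = 0 by rewrite !subr0.
by have := pos_coneZ f (lexx 0) x0; rewrite scale0r mul0r.
Qed.

Lemma dual_pos_sup f x : vle 0 x ->
  dual_pos f x = sup [set (f y : R) | y in [set y | vle 0 y /\ vle y x]] :> R.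
Proof. exact: dual_posE. Qed.

Definition dual_sup f g : dual F := g + dual_pos (f - g).
Definition dual_inf f g : dual F := - dual_sup (- f) (- g).

Let dual_le_refl f : dual_le f f. Proof. by move=> x x0. Qed.

Let dual_le_anti f g : dual_le f g -> dual_le g f -> f = g.
Proof.
move=> fg gf; apply: bounded_op_ext => x.
have E y : vle 0 y -> f y = g y.
  by move=> y0; apply/eqP; rewrite eq_le; apply/andP; split; [exact: fg|exact: gf].
by have [a [b [a0 b0 ->]]] := vdecomp x; rewrite !linearB !E.
Qed.

Let dual_le_trans g f h : dual_le f g -> dual_le g h -> dual_le f h.
Proof. by move=> fg gh x x0; rewrite (le_trans (fg x x0))// gh. Qed.

Let dualDE f g x : (f + g) x = (f x : R) + g x :> R. Proof. by []. Qed.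
Let dualNE f x : (- f) x = - (f x : R) :> R. Proof. by []. Qed.

Let dual_supP f g h : dual_le (dual_sup f g) h <-> dual_le f h /\ dual_le g h.
Proof.
split=> [H|[fh gh] x x0].
  split=> x x0; have := H x x0; rewrite /dual_sup dualDE dual_posE//;
      apply: le_trans.
    rewrite -lerBlDl; have := pos_ub (f - g) x0 (vle_refl x).
    by rewrite dualDE dualNE.
  by rewrite lerDl pos_cone_ge0.
rewrite /dual_sup dualDE dual_posE// -lerBrDl.
apply: pos_lub => // y y0 yx; rewrite dualDE dualNE lerBlDr.
have xy0 : vle 0 (x - y) by exact/vle_subr0.
rewrite (le_trans (fh _ y0))//.
have : (g x : R) - g y <= (h x : R) - h y by rewrite -!linearB; exact: gh.
lra.
Qed.

Let dual_leN f g : dual_le (- f) (- g) <-> dual_le g f.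
Proof. by split=> fg x x0; have := fg x x0; rewrite !dualNE lerN2. Qed.

Let dual_infP f g h : dual_le h (dual_inf f g) <-> dual_le h f /\ dual_le h g.
Proof.
rewrite -dual_leN opprK; split; first by move=> /dual_supP[/dual_leN ? /dual_leN].
by move=> [/dual_leN ? /dual_leN ?]; exact/dual_supP.
Qed.

Let dual_le_add h f g : dual_le f g -> dual_le (f + h) (g + h).
Proof. by move=> fg x x0; rewrite !dualDE lerD2r fg. Qed.

Let dual_le_scale (a : R) f g : 0 <= a -> dual_le f g -> dual_le (a *: f) (a *: g).
Proof. by move=> a0 fg x x0; rewrite ler_wpM2l// fg. Qed.

Let dual_abs f := dual_sup f (- f).

Let dual_absP f x : `|(f x : R)| <= dual_abs f (vabs x).
Proof.
have [fa Nfa] : dual_le f (dual_abs f) /\ dual_le (- f) (dual_abs f).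
  by apply/dual_supP; exact: dual_le_refl.
have p0 : vle 0 (vabs x + x).
  by rewrite -[x in _ + x]opprK; apply/vle_subr0; exact: vle_absN.
have m0 : vle 0 (vabs x - x) by apply/vle_subr0; exact: vle_abs.
have D g y z : g (y + z) = (g y : R) + g z :> R by rewrite linearD.
have N g y : g (- y) = - (g y : R) :> R by rewrite linearN.
have := fa _ p0; have := Nfa _ p0; have := fa _ m0; have := Nfa _ m0.
rewrite !dualNE !D !N ler_norml => ? ? ? ?; apply/andP; split; lra.
Qed.

Let dual_abs_norm f x : vle 0 x -> (dual_abs f x : R) <= `|f| * `|x|.
Proof.
move=> x0; rewrite /dual_abs /dual_sup dualDE dual_posE// dualNE addrC lerBlDr.
apply: pos_lub => // y y0 yx.
rewrite opprK dualDE -lerBlDr -[leLHS]/((f y : R) + f y - f x).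
have <- : (f (y + y - x) : R) = (f y : R) + f y - f x.
  by rewrite linearB linearD.
rewrite (le_trans (ler_norm _))// (le_trans (dual_op_normr _ _))// ler_wpM2l//.
apply: vle_abs_norm; apply/vabs_le; split; apply/vle_subr0.
  by rewrite opprB opprD addrA addrACA; apply: vle_addr0; exact/vle_subr0.
by rewrite opprK addrC subrK; exact: vle_addr0.
Qed.

Let dual_le_norm f g : dual_le (dual_abs f) (dual_abs g) -> `|f| <= `|g|.
Proof.
move=> fg; apply: op_norm_le => // x.
rewrite (le_trans (dual_absP _ _))// (le_trans (fg _ (vabs_ge0 x)))//.
by rewrite (le_trans (dual_abs_norm _ (vabs_ge0 x)))// vabs_normE.
Qed.

HB.instance Definition _ := isBanachLattice.Build R (dual F)
  dual_le_refl dual_le_anti dual_le_trans dual_supP dual_infP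
  dual_le_add dual_le_scale dual_le_norm.

Lemma dual_vleE f g : vle f g <-> forall x, vle 0 x -> (f x : R) <= g x.
Proof. by []. Qed.

End dual_lattice.

Definition in_ell (R : realType) (p : R) (u : nat -> R) : Prop :=
  cvgn (series (fun n => `|u n| `^ p)).

Record ell1 (R : realType) := Ell1 {
  ell1_val :> nat -> R ;
  ell1P : in_ell 1 ell1_val }.

Arguments ell1P {R} _.

Section ell1_theory.
Context {R : realType}.
Implicit Types (u v : nat -> R) (x y : ell1 R).

HB.instance Definition _ := gen_eqMixin (ell1 R).
HB.instance Definition _ := gen_choiceMixin (ell1 R).

Lemma ell1_ext x y : x =1 y -> x = y.
Proof.
case: x y => [u uP] [v vP] /= /funext uv; subst v.
by congr Ell1; exact: Prop_irrelevance.
Qed.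

Let asum u n : R := \sum_(0 <= k < n) `|u k|.

Let asum_homo u : {homo asum u : n m / (n <= m)%N >-> n <= m}.
Proof. by move=> n m nm; apply: nondecreasing_series. Qed.

Let asumE u : series (fun n => `|u n| `^ 1) = asum u.
Proof.
by apply/funext => n; rewrite /series/= /asum; apply: eq_bigr => k _; rewrite powRr1.
Qed.

Let in_ell1P u : in_ell 1 u <-> exists M, forall n, asum u n <= M.
Proof.
rewrite /in_ell asumE; split => [uc|[M uM]].
  by exists (limn (asum u)) => n; apply: nondecreasing_cvgn_le.
apply: nondecreasing_is_cvgn; first exact: asum_homo.
by exists M => _ [n _ <-].
Qed.

Let asumD u v n : asum (fun k => u k + v k) n <= asum u n + asum v n.
Proof. by rewrite /asum -big_split /= ler_sum// => k _; exact: ler_normD. Qed.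

Let asumZ a u n : asum (fun k => a * u k) n = `|a| * asum u n.
Proof. by rewrite /asum mulr_sumr; apply: eq_bigr => k _; rewrite normrM. Qed.

Lemma ell1_zero_subproof : in_ell 1 (fun=> 0 : R).
Proof. by apply/in_ell1P; exists 0 => n; rewrite /asum big1// => k; rewrite normr0. Qed.

Lemma ell1_add_subproof x y : in_ell 1 (fun k => x k + y k).
Proof.
have /in_ell1P[M xM] := ell1P x; have /in_ell1P[N yN] := ell1P y.
apply/in_ell1P; exists (M + N) => n.
by rewrite (le_trans (asumD _ _ _))// lerD.
Qed.
Arguments ell1_add_subproof : clear implicits.

Lemma ell1_scale_subproof a x : in_ell 1 (fun k => a * x k).
Proof.
have /in_ell1P[M xM] := ell1P x; apply/in_ell1P; exists (`|a| * M) => n.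
by rewrite asumZ ler_wpM2l.
Qed.
Arguments ell1_scale_subproof : clear implicits.

Lemma ell1_opp_subproof x : in_ell 1 (fun k => - x k).
Proof.
have /in_ell1P[M xM] := ell1P x; apply/in_ell1P; exists M => n.
by rewrite /asum; under eq_bigr do rewrite normrN; exact: xM.
Qed.
Arguments ell1_opp_subproof : clear implicits.

Let add x y := Ell1 (ell1_add_subproof x y).
Let zero := Ell1 ell1_zero_subproof.
Let opp x := Ell1 (ell1_opp_subproof x).
Let scale a x := Ell1 (ell1_scale_subproof a x).

Let addA : associative add.
Proof. by move=> x y z; apply: ell1_ext => k /=; rewrite addrA. Qed.
Let addC : commutative add.
Proof. by move=> x y; apply: ell1_ext => k /=; rewrite addrC. Qed.
Let add0 : left_id zero add.
Proof. by move=> x; apply: ell1_ext => k /=; rewrite add0r. Qed.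
Let addN : left_inverse zero opp add.
Proof. by move=> x; apply: ell1_ext => k /=; rewrite addNr. Qed.

HB.instance Definition _ := GRing.isZmodule.Build (ell1 R) addA addC add0 addN.

Let scaleA a b x : scale a (scale b x) = scale (a * b) x.
Proof. by apply: ell1_ext => k /=; rewrite mulrA. Qed.
Let scale1 : left_id 1 scale.
Proof. by move=> x; apply: ell1_ext => k /=; rewrite mul1r. Qed.
Let scaleDr : right_distributive scale +%R.
Proof. by move=> a x y; apply: ell1_ext => k /=; rewrite mulrDr. Qed.
Let scaleDl x : {morph scale^~ x : a b / a + b}.
Proof. by move=> a b; apply: ell1_ext => k /=; rewrite mulrDl. Qed.

HB.instance Definition _ := GRing.Zmodule_isLmodule.Build R (ell1 R)
  scaleA scale1 scaleDr scaleDl.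

Definition ell1_norm x : R := limn (series (fun n => `|x n|)).

Let asum_le_norm x n : asum x n <= ell1_norm x.
Proof.
apply: nondecreasing_cvgn_le; first exact: asum_homo.
by rewrite -asumE; exact: ell1P.
Qed.

Let ell1_norm_le x M : (forall n, asum x n <= M) -> ell1_norm x <= M.
Proof.
move=> xM; apply: limr_le; last by near=> n; exact: xM.
by have := ell1P x; rewrite /in_ell asumE.
Unshelve. all: by end_near. Qed.

Let le_norm x k : `|x k| <= ell1_norm x.
Proof.
rewrite (le_trans _ (asum_le_norm x k.+1))// /asum big_nat_recr//= lerDr.
exact: sumr_ge0.
Qed.

Let ell1_normD x y : ell1_norm (x + y) <= ell1_norm x + ell1_norm y.
Proof.
apply: ell1_norm_le => n; rewrite (le_trans (asumD _ _ _))//.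
by rewrite lerD ?asum_le_norm.
Qed.

Let ell1_normZ a x : ell1_norm (a *: x) = `|a| * ell1_norm x.
Proof.
have le b y : ell1_norm (b *: y) <= `|b| * ell1_norm y.
  by apply: ell1_norm_le => n; rewrite asumZ ler_wpM2l// asum_le_norm.
apply/eqP; rewrite eq_le le /=.
have [->|a0] := eqVneq a 0.
  by rewrite normr0 mul0r (le_trans _ (le_norm _ 0%N)).
by rewrite -ler_pdivlMl ?normr_gt0// -normfV -{1}[x](scalerK a0) le.
Qed.

Let ell1_norm_eq0 x : ell1_norm x = 0 -> x = 0.
Proof.
move=> x0; apply: ell1_ext => k; apply/eqP; rewrite -normr_le0 -x0.
exact: le_norm.
Qed.

HB.instance Definition _ := Lmodule_isNormed.Build R (ell1 R)
  ell1_normD ell1_normZ ell1_norm_eq0.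

Let ell1_cauchy (F : set_system (ell1 R)) :
  ProperFilter F -> cauchy F -> cvg F.
Proof.
move=> FF /cauchy_ballP Fc.
have Fe e : 0 < e -> exists A B : set (ell1 R),
    [/\ F A, F B & forall x y, A x -> B y -> ell1_norm (x - y) < e].
  move=> /Fc[[A B] [FA FB] AB]; exists A, B; split => // x y Ax By.
  by have := AB (x, y); rewrite -ball_normE/=; apply; split.
have Fx k : cvg ((fun x : ell1 R => x k) @ F).
  apply/cauchy_cvgP/cauchy_ballP => e e0.
  have [A [B [FA FB AB]]] := Fe _ e0.
  exists ((fun x : ell1 R => x k) @` A, (fun x : ell1 R => x k) @` B).
    by split; [apply: (@filterS _ F _ A)|apply: (@filterS _ F _ B)] => // x;
      exists x.
  move=> [_ _] [/= [x Ax <-] [y By <-]]; rewrite -ball_normE/=.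
  by rewrite (le_lt_trans (le_norm (x - y) k))// AB.
pose L k : R := lim ((fun x : ell1 R => x k) @ F).
have LP k : (fun x : ell1 R => x k) @ F --> L k by exact: Fx.
have LF e : 0 < e ->
    \forall x \near F, forall n, asum (fun k => (x : ell1 R) k - L k) n <= e.
  move=> /Fe[A [B [FA FB AB]]]; apply: filterS FA => x Ax n.
  have cvgn_sum : (fun y : ell1 R => asum (fun k => x k - y k) n) @ F -->
      asum (fun k => x k - L k) n.
    apply: cvg_big => [|k _]; first exact: add_continuous.
    by apply: cvg_norm; apply: cvgB => //; exact: cvg_cst.
  rewrite -(cvg_lim (@norm_hausdorff _ _) cvgn_sum).
  apply: limr_le; first by apply/cvg_ex; eexists; exact: cvgn_sum.
  apply: filterS FB => y By.
  by rewrite (le_trans (asum_le_norm (x - y) n))// ltW// AB.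
have Lb : in_ell 1 L.
  have [x xL] := @filter_ex _ _ FF _ (LF _ ltr01).
  apply/in_ell1P; exists (ell1_norm x + 1) => n.
  have -> : asum L n = asum (fun k => x k + (- 1) * (x k - L k)) n.
    by apply: eq_bigr => k _; congr `|_|; ring.
  rewrite (le_trans (asumD _ _ _))// lerD ?asum_le_norm//.
  by rewrite asumZ normrN1 mul1r.
apply/cvg_ex; exists (Ell1 Lb); apply/cvgrPdist_le => e e0.
apply: filterS (LF _ e0) => x xL; rewrite distrC.
by apply: ell1_norm_le => n; exact: xL.
Qed.

HB.instance Definition _ := Uniform_isComplete.Build (ell1 R) ell1_cauchy.

End ell1_theory.

Definition weakly_p_summable (R : realType) (p : R) (Z : normedModType R)
    (z : nat -> Z) : Prop :=
  forall f : dual Z, in_ell p (fun n => f (z n)).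

Definition disjoint_seq (R : realType) (E : banachLatticeType R)
    (x : nat -> E) : Prop :=
  forall n m, n != m -> vinf (vabs (x n)) (vabs (x m)) = 0.

Definition disjoint_p_convergent (R : realType) (p : R) (E : banachLatticeType R)
    (Y : completeNormedModType R) (T : bounded_op E Y) : Prop :=
  forall x : nat -> E, disjoint_seq x -> weakly_p_summable p x ->
    (`|T (x n)| : R) @[n --> \oo] --> (0 : R).

(* [q_S(x)]; the real [sup] is meaningful: the set is nonempty and bounded
   by [`|S| * `|x|]. *)
Definition lattice_seminorm (R : realType) (H : banachLatticeType R)
    (Y : completeNormedModType R) (S : bounded_op H Y) (x : H) : R :=
  sup [set `|S y| | y in [set y | vle (vabs y) (vabs x)]].

(* Main.v *)
Require Import Defs.
From HB Require Import structures.
From mathcomp Require Import all_boot all_order all_algebra.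
From mathcomp Require Import all_classical all_reals all_analysis.
From mathcomp Require Import lra.

Import Order.TTheory GRing.Theory Num.Theory.
Import numFieldNormedType.Exports.

Local Open Scope classical_set_scope.
Local Open Scope ring_scope.

Set Implicit Arguments.
Unset Strict Implicit.
Unset Printing Implicit Defensive.

(** The equivalences rest on one fact about the dual lattice of [F]: if [y] is
    disjoint and weakly [p]-summable, then every sequence [z] dominated by [y],
    in the sense that [|z n| <= |y n|], is weakly [p]-summable as well
    ([disjoint_weakly_p_summable_le]); it is of course also disjoint
    ([disjoint_seq_le]).  Thus a disjoint weakly [p]-summable sequence may be
    replaced by its absolute values, by its positive or negative parts, or by
    near-maximizers for the lattice seminorm [q] of the adjoint of [T], without
    leaving the class.

    To see the fact, let [phi] be a functional on [dual F] and
    [t n := |phi| (|y n|)], which dominates [|phi (z n)|].  Combinations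
    [\sum_k a k *: y k], with nonnegative [a] bounded in the dual norm of
    [ell_p], are pointwise bounded on [F], hence bounded in norm by the uniform
    boundedness principle.  Since [y] is disjoint, the norm stays the same when
    each [y k] is replaced by [|y k|] ([norm_sum_vabs]), so the sums
    [\sum_k a k * t k] are bounded, and [t] is in [ell_p] by duality
    ([in_ell_dual]).

    Granted this, (a) gives (b) by applying (a) to [z n] with [|z n| <= |y n|]
    at which the supremum defining [q (y n)] is attained up to a factor 2.
    (c) gives (d) because [q (y n) = q (|y n|)] dominates the norm of the image
    of [y n] under the adjoint of [T].  For (f), [y n] is split as a difference
    of positive elements below [|y n|], and (e) is used along the images under
    [S] of vectors of the unit ball norming up to a factor 2.  For (g), [ell1] is itself a
    Banach lattice, and (a) follows from (g) with the operator [S] that sends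
    the [n]-th unit vector to an [x n] in the unit ball of [X] nearly norming
    the image of [y n] ([ell1_lift]). *)

(** * Disjointness in a Banach lattice *)

Section lattice.
Context {R : realType} {E : banachLatticeType R}.
Implicit Types a b c x y z : E.

Lemma vle_add2 a b x y : vle a b -> vle x y -> vle (a + x) (b + y).
Proof.
move=> ab xy; apply: (vle_trans (b + x)); first exact: vle_add.
by rewrite ![b + _]addrC; exact: vle_add.
Qed.

Lemma vabsN x : vabs (- x) = vabs x.
Proof.
by apply: vle_anti; apply/vabs_le; rewrite ?opprK; split;
  [exact: vle_absN|exact: vle_abs|
   rewrite -[X in vle X _]opprK; exact: vle_absN|exact: vle_abs].
Qed.

Lemma vabsD x y : vle (vabs (x + y)) (vabs x + vabs y).
Proof.
apply/vabs_le; rewrite opprD; split; apply: vle_add2;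
  by [exact: vle_abs|exact: vle_absN].
Qed.

Lemma vabsZ (k : R) x : 0 <= k -> vabs (k *: x) = k *: vabs x.
Proof.
have le (l : R) y : 0 <= l -> vle (vabs (l *: y)) (l *: vabs y).
  move=> l0; apply/vabs_le; rewrite -scalerN.
  by split; apply: vle_scale => //; [exact: vle_abs|exact: vle_absN].
rewrite le_eqVlt => /predU1P[<-|k0].
  by rewrite !scale0r vabs_id//; exact: vle_refl.
apply: vle_anti; first by apply: le; exact: ltW.
have := le k^-1 (k *: x); rewrite scalerA mulVf ?gt_eqF// scale1r invr_ge0.
move=> /(_ (ltW k0))/(vle_scale (ltW k0)).
by rewrite scalerA mulfV ?gt_eqF// scale1r.
Qed.

Lemma vinf_ge0 x y : vle 0 x -> vle 0 y -> vle 0 (vinf x y).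
Proof. by move=> x0 y0; apply/vinfP. Qed.

Lemma vinfC x y : vinf x y = vinf y x.
Proof.
by apply: vle_anti; apply/vinfP; split; [exact: vle_infr|exact: vle_infl|
  exact: vle_infr|exact: vle_infl].
Qed.

Lemma vinf0_le a b x y : vle 0 a -> vle 0 b -> vle a x -> vle b y ->
  vinf x y = 0 -> vinf a b = 0.
Proof.
move=> a0 b0 ax bY xy; apply: vle_anti; last exact: vinf_ge0.
rewrite -xy; apply/vinfP; split.
  by apply: vle_trans ax; exact: vle_infl.
by apply: vle_trans bY; exact: vle_infr.
Qed.

(** By the Riesz decomposition an element below [a + b] and [c] is a sum of
    one below [a] and [c] and one below [b] and [c]. *)
Lemma vinf0_add a b c : vle 0 a -> vle 0 b -> vle 0 c ->
  vinf a c = 0 -> vinf b c = 0 -> vinf (a + b) c = 0.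
Proof.
move=> a0 b0 c0 ac bc.
have w0 : vle 0 (vinf (a + b) c) by apply: vinf_ge0 => //; exact: vle_addr0.
apply: vle_anti => //.
have [y1 [y2 [wE y10 y1a y20 y2b]]] := riesz_decomp a0 b0 w0 (vle_infl _ _).
have wc : vle (y1 + y2) c by rewrite -wE; exact: vle_infr.
have y1w : vle y1 (y1 + y2) by apply/vle_subr0; rewrite addrC addKr.
have y2w : vle y2 (y1 + y2) by apply/vle_subr0; rewrite addrK.
rewrite wE -[X in vle _ X]addr0; apply: vle_add2.
  by rewrite -ac; apply/vinfP; split=> //; exact: vle_trans wc.
by rewrite -bc; apply/vinfP; split=> //; exact: vle_trans wc.
Qed.

(** Both [k *: a] and [c] lie below the multiples of [a] and [c] by [k + 1], so
    dividing by [k + 1] brings the infimum below that of [a] and [c]. *)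
Lemma vinf0_scale (k : R) a c : 0 <= k -> vle 0 a -> vle 0 c ->
  vinf a c = 0 -> vinf (k *: a) c = 0.
Proof.
move=> k0 a0 c0 ac.
have m0 : 0 < k + 1 by rewrite ltr_wpDl.
have m1 : 0 <= (k + 1)^-1 by rewrite invr_ge0 ltW.
have grow (l : R) x : 0 <= l -> l <= k + 1 -> vle 0 x ->
    vle ((k + 1)^-1 *: (l *: x)) x.
  move=> l0 lk x0; apply/vle_subr0.
  rewrite scalerA -[X in X - _]scale1r -scalerBl; apply: vle_scale0 => //.
  by rewrite subr_ge0 mulrC ler_pdivrMr// mul1r.
have w0 : vle 0 (vinf (k *: a) c) by apply: vinf_ge0 => //; exact: vle_scale0.
apply: vle_anti => //.
have : vle ((k + 1)^-1 *: vinf (k *: a) c) 0.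
  rewrite -ac; apply/vinfP; split.
    apply: (vle_trans ((k + 1)^-1 *: (k *: a))).
      by apply: vle_scale => //; exact: vle_infl.
    by apply: grow; rewrite ?lerDl.
  apply: (vle_trans ((k + 1)^-1 *: (1 *: c))).
    by apply: vle_scale => //; rewrite scale1r; exact: vle_infr.
  by apply: grow; rewrite ?lerDr.
move=> /(vle_scale (ltW m0)).
by rewrite scalerA mulfV ?gt_eqF// scale1r scaler0.
Qed.

(** Half of [|x| + |y| - |x + y|] lies below both [|x|] and [|y|] by the
    triangle inequality, hence below their infimum. *)
Lemma vabsD_disjoint x y : vinf (vabs x) (vabs y) = 0 ->
  vabs (x + y) = vabs x + vabs y.
Proof.
move=> xy; apply: vle_anti; first exact: vabsD.
set u := vabs x; set v := vabs y; set s := vabs (x + y).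
have us : vle u (s + v) by have := vabsD (x + y) (- y); rewrite addrK vabsN.
have vs : vle v (s + u).
  by have := vabsD (x + y) (- x); rewrite addrAC subrr add0r vabsN.
have half (w t : E) : vle t (w + w) -> vle ((2^-1 : R) *: t) w.
  have h0 : 0 <= 2^-1 :> R by rewrite invr_ge0.
  have -> : w + w = (2 : R) *: w by rewrite scaler_nat mulr2n.
  by move=> /(vle_scale h0); rewrite scalerA mulVf ?pnatr_eq0// scale1r.
have : vle ((2^-1 : R) *: (u + v - s)) 0.
  rewrite -xy; apply/vinfP; split; apply: half.
    by have := vle_add (u - s) vs; rewrite [s + u]addrC addrACA subrr addr0
      addrA [v + u]addrC.
  by have := vle_add (v - s) us; rewrite [s + v]addrC addrACA subrr addr0 addrA.
have t0 : 0 <= 2 :> R by [].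
move=> /(vle_scale t0); rewrite scalerA mulfV ?pnatr_eq0// scale1r scaler0.
by move=> /(vle_add s); rewrite subrK add0r.
Qed.

Lemma sum_vabs_ge0 (x : nat -> E) n : vle 0 (\sum_(k < n) vabs (x k)).
Proof.
elim: n => [|n IH]; first by rewrite big_ord0; exact: vle_refl.
by rewrite big_ord_recr /=; apply: vle_addr0 => //; exact: vabs_ge0.
Qed.

Lemma vabs_sum_disjoint (x : nat -> E) n : disjoint_seq x ->
  vabs (\sum_(k < n) x k) = \sum_(k < n) vabs (x k).
Proof.
move=> xd; elim: n => [|n IH].
  by rewrite !big_ord0 vabs_id//; exact: vle_refl.
rewrite !big_ord_recr /= vabsD_disjoint ?IH//.
suff H m : (m <= n)%N -> vinf (\sum_(k < m) vabs (x k)) (vabs (x n)) = 0.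
  exact: H.
elim: m => [|m IHm mn].
  rewrite big_ord0 => _; apply: vle_anti; first exact: vle_infl.
  by apply: vinf_ge0; [exact: vle_refl|exact: vabs_ge0].
rewrite big_ord_recr /=; apply: vinf0_add.
- exact: sum_vabs_ge0.
- exact: vabs_ge0.
- exact: vabs_ge0.
- by apply: IHm; exact: ltnW.
- by apply: xd; rewrite neq_ltn mn.
Qed.

Lemma disjoint_seq_le (x y : nat -> E) :
  (forall n, vle (vabs (x n)) (vabs (y n))) -> disjoint_seq y -> disjoint_seq x.
Proof.
by move=> xy yd n m /yd; apply: vinf0_le => //; exact: vabs_ge0.
Qed.

Lemma disjoint_seq_scale (k : nat -> R) (x : nat -> E) :
  (forall n, 0 <= k n) -> disjoint_seq x -> disjoint_seq (fun n => k n *: x n).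
Proof.
move=> k0 xd n m nm; rewrite !vabsZ//.
have va i := vabs_ge0 (x i).
apply: vinf0_scale => //; first exact: vle_scale0.
by rewrite vinfC; apply: vinf0_scale => //; rewrite vinfC; exact: xd.
Qed.

Lemma norm_sum_vabs (k : nat -> R) (x : nat -> E) n :
  (forall i, 0 <= k i) -> disjoint_seq x ->
  `|\sum_(i < n) k i *: vabs (x i)| = `|\sum_(i < n) k i *: x i|.
Proof.
move=> k0 xd; rewrite -[RHS]vabs_normE.
rewrite (@vabs_sum_disjoint (fun i => k i *: x i)); last exact: disjoint_seq_scale.
by congr `|_|; apply: eq_bigr => i _; rewrite vabsZ.
Qed.

(** The positive and negative parts. *)
Lemma vdecomp_vabs x : exists a b,
  [/\ vle 0 a /\ vle a (vabs x), vle 0 b /\ vle b (vabs x) & x = a - b].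
Proof.
have x0 := vabs_ge0 x.
exists (vsup x 0), (vsup x 0 - x); split; last by rewrite subKr.
  by split; [exact: vle_supr|apply/vsupP; split => //; exact: vle_abs].
split; first by apply/vle_subr0; exact: vle_supl.
have : vle (vsup x 0) (vabs x + x).
  apply/vsupP; split; apply/vle_subr0; first by rewrite addrK.
  by rewrite subr0 -[x in _ + x]opprK; apply/vle_subr0; exact: vle_absN.
by move=> /(vle_add (- x)); rewrite addrK.
Qed.

End lattice.

(** * Functionals and weak summability *)

Section functionals.
Context {R : realType}.

Lemma dual_op_normr (V : normedModType R) (f : dual V) x :
  `|(f x : R)| <= `|f| * `|x|.
Proof. exact: op_normr. Qed.

Lemma dual_near_norming (V : normedModType R) (f : dual V) :
  exists2 x : V, `|x| <= 1 & `|f| <= 2 * `|(f x : R)|.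
Proof.
have [f0|f0] := eqVneq f 0.
  by exists 0; rewrite ?normr0// f0 !normr0 mulr0.
have fp : `|f| / 2 < `|f| by rewrite ltr_pdivrMr// ltr_pMr ?normr_gt0// ltr1n.
suff [x x1 fx] : exists2 x : V, `|x| <= 1 & `|f| / 2 < `|(f x : R)|.
  by exists x => //; rewrite mulrC -ler_pdivrMr// ltW.
apply: contrapT => H; move: fp; rewrite ltNge => /negP; apply.
apply: ge_sup; first by exists `|f 0|, 0 => //=; rewrite normr0.
by move=> _ [x /= x1 <-]; rewrite leNgt; apply/negP => fx; apply: H; exists x.
Qed.

Lemma dual_vabs (F : banachLatticeType R) (f : dual F) x :
  `|(f x : R)| <= (vabs f) (vabs x).
Proof.
have fa : vle f (vabs f) := vle_abs f.
have Nfa : vle (- f) (vabs f) := vle_absN f.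
have p0 : vle 0 (vabs x + x).
  by rewrite -[x in _ + x]opprK; apply/vle_subr0; exact: vle_absN.
have m0 : vle 0 (vabs x - x) by apply/vle_subr0; exact: vle_abs.
have D (g : dual F) y z : g (y + z) = (g y : R) + g z :> R by rewrite linearD.
have N (g : dual F) y : g (- y) = - (g y : R) :> R by rewrite linearN.
have := fa _ p0; have := Nfa _ p0; have := fa _ m0; have := Nfa _ m0.
have DN y : (- f) y = - (f y : R) :> R by [].
rewrite !DN !D !N ler_norml => ? ? ? ?; apply/andP; split; lra.
Qed.

(** The Banach-Steinhaus theorem on [V].  Weak summability of a sequence in
    [dual V] supplies the pointwise bounds, through the evaluations at points
    of [V]. *)
Lemma dual_uniform_bound (V : completeNormedModType R) (A : set (dual V)) :
  (forall x : V, exists M, forall f, A f -> `|(f x : R)| <= M) ->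
  exists2 M, 0 <= M & forall f, A f -> `|f| <= M.
Proof.
move=> ptw.
pose B : set (V -> R) := [set (f : V -> R) | f in A].
have [||M BM] := @Banach_Steinhauss R V R B _ _ 1.
- move=> _ [f Af <-]; split; last by move=> a x y; rewrite linearP.
  move=> r; exists (`|f| * r) => x xr.
  by rewrite (le_trans (dual_op_normr _ _))// ler_wpM2l.
- by move=> x; have [M fM] := ptw x; exists M => _ [f Af <-]; exact: fM.
exists (2 * `|M|) => [|f Af]; first by rewrite mulr_ge0.
have [x x1 fx] := dual_near_norming f.
rewrite (le_trans fx)// ler_wpM2l// (le_trans _ (ler_norm _))//.
by apply: BM => //; exists f.
Qed.

End functionals.

Section in_ell.
Context {R : realType}.
Implicit Types (p : R) (u v : nat -> R).

Lemma in_ellP p u :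
  in_ell p u <-> exists M, forall n, \sum_(k < n) `|u k| `^ p <= M.
Proof.
pose s := series (fun n => `|u n| `^ p).
have sE n : s n = \sum_(k < n) `|u k| `^ p by rewrite /s /series /= big_mkord.
have sh : {homo s : n m / (n <= m)%N >-> n <= m}.
  by apply: nondecreasing_series => n _ _; exact: powR_ge0.
rewrite /in_ell -/s; split => [sc|[M sM]].
  by exists (limn s) => n; rewrite -sE; exact: nondecreasing_cvgn_le.
apply: nondecreasing_is_cvgn => //.
by exists M => _ [n _ <-]; rewrite sE.
Qed.

Lemma in_ell_le p u v : 0 <= p -> (forall n, `|u n| <= `|v n|) ->
  in_ell p v -> in_ell p u.
Proof.
move=> p0 uv /in_ellP[M vM]; apply/in_ellP; exists M => n.
rewrite (le_trans _ (vM n))//; apply: ler_sum => k _.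
by apply: ge0_ler_powR; rewrite ?nnegrE.
Qed.

(** A Young inequality with constants 1: the left-hand side is at most the
    [p]-th power of the larger of the two numbers. *)
Lemma powR_mul_le p (t u : R) : 1 <= p -> 0 <= t -> 0 <= u ->
  t `^ (p - 1) * u <= t `^ p + u `^ p.
Proof.
move=> p1 t0 u0.
have pE : (p - 1) + 1 = p by rewrite subrK.
have pn0 : p - 1 + 1 != 0 by rewrite pE gt_eqF// (lt_le_trans _ p1).
have mulE (w : R) : 0 <= w -> w `^ (p - 1) * w = w `^ p.
  move=> w0; rewrite -[in RHS]pE (@powRD _ _ (p - 1) 1); last by rewrite (negPf pn0).
  by rewrite powRr1.
have [tu|ut] := leP t u.
  apply: (@le_trans _ _ (u `^ p)); last by rewrite lerDr powR_ge0.
  rewrite -(mulE _ u0) ler_wpM2r//.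
  by apply: ge0_ler_powR; rewrite ?nnegrE// subr_ge0.
apply: (@le_trans _ _ (t `^ p)); last by rewrite lerDl powR_ge0.
by rewrite -(mulE _ t0) ler_wpM2l ?powR_ge0// ltW.
Qed.

(** The converse of Hoelder's inequality.  The inner hypothesis on [a] says that
    [a] is bounded as a functional on [ell_p]; it plays the role of the unit
    ball of [ell_p'], treats [p = 1] uniformly, and holds for the extremal
    coefficients [(t k / l) `^ (p - 1)], where [l] is the [ell_p] norm of the
    first [n] terms. *)
Lemma in_ell_dual p (t : nat -> R) (C : R) : 1 <= p -> (forall n, 0 <= t n) ->
  (forall n (a : nat -> R), (forall k, 0 <= a k) ->
     (forall u : nat -> R, (forall k, 0 <= u k) ->
        \sum_(k < n) a k * u k <= 1 + \sum_(k < n) u k `^ p) ->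
     \sum_(k < n) a k * t k <= C) ->
  in_ell p t.
Proof.
move=> p1 t0 H; have p0 : 0 < p by exact: lt_le_trans p1.
apply/in_ellP; exists (C `^ p) => n.
set S := \sum_(k < n) _.
have S0 : 0 <= S by apply: sumr_ge0 => k _; exact: powR_ge0.
have [->|Sn0] := eqVneq S 0; first exact: powR_ge0.
pose l := S `^ p^-1.
have lp : l `^ p = S by rewrite /l -powRrM mulVf ?gt_eqF// powRr1.
have l0 : 0 < l by apply: powR_gt0; rewrite lt_neqAle eq_sym Sn0.
pose a k := (t k / l) `^ (p - 1).
have tl0 k : 0 <= t k / l by rewrite divr_ge0// ltW.
have tl : \sum_(k < n) (t k / l) `^ p = 1.
  transitivity (\sum_(k < n) (`|t k| `^ p) / S).
    apply: eq_bigr => k _; have li : 0 <= l^-1 by rewrite invr_ge0 ltW.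
    rewrite ger0_norm// powRM// -lp; congr (_ * _).
    by rewrite -powR_inv1 ?ltW// -powRrM mulrC powRrM powR_inv1// powR_ge0.
  by rewrite -mulr_suml mulfV.
have : \sum_(k < n) a k * t k <= C.
  apply: H => [k|u u0]; first exact: powR_ge0.
  rewrite -tl -big_split /=; apply: ler_sum => k _.
  exact: powR_mul_le.
have -> : \sum_(k < n) a k * t k = l.
  rewrite -[RHS]mulr1 -tl mulr_sumr; apply: eq_bigr => k _.
  have pE : (p - 1) + 1 = p by rewrite subrK.
  rewrite -[in RHS]pE (@powRD _ _ (p - 1) 1); last by rewrite pE gt_eqF.
  by rewrite powRr1// /a mulrCA [l * _]mulrC divfK ?gt_eqF.
move=> lC; rewrite -lp; apply: ge0_ler_powR => //; rewrite ?nnegrE ltW//.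
exact: lt_le_trans lC.
Qed.

End in_ell.

Section evaluation.
Context {R : realType} {V : normedModType R} (x : V).

Definition dual_eval_fun (f : dual V) : R := f x.

Lemma dual_eval_linear : linear dual_eval_fun.
Proof. by []. Qed.

HB.instance Definition _ :=
  GRing.isLinear.Build R (dual V) R _ dual_eval_fun dual_eval_linear.

Lemma dual_eval_bounded : bounded_near dual_eval_fun (nbhs (0 : dual V)).
Proof.
apply: (@bounded_near_linear _ _ _ _ `|x|) => f.
by rewrite mulrC; exact: dual_op_normr.
Qed.

Definition dual_eval : dual (dual V) := BoundedOp dual_eval_bounded.

Lemma dual_sumE (f : nat -> dual V) n :
  (\sum_(k < n) f k) x = \sum_(k < n) (f k x : R).
Proof. exact: (big_morph dual_eval_fun). Qed.

End evaluation.

(** This is where disjointness matters: it makes the norm of a combination of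
    the [y k] with nonnegative coefficients insensitive to replacing [y k] by
    its absolute value.  Such combinations, with coefficients bounded on
    [ell_p], form a pointwise bounded set of functionals on [F], hence a norm
    bounded one; testing the absolute values against a positive functional and
    dualizing back gives [p]-summability, which passes to everything dominated
    by the [y k]. *)
Lemma disjoint_weakly_p_summable_le (R : realType) (F : banachLatticeType R)
    (p : R) (y z : nat -> dual F) : 1 <= p ->
  (forall n, vle (vabs (z n)) (vabs (y n))) ->
  disjoint_seq y -> weakly_p_summable p y -> weakly_p_summable p z.
Proof.
move=> p1 zy yd ys phi.
pose adm n (a : nat -> R) := (forall k, 0 <= a k) /\
  forall u : nat -> R, (forall k, 0 <= u k) ->
    \sum_(k < n) a k * u k <= 1 + \sum_(k < n) u k `^ p.
pose A : set (dual F) :=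
  [set f | exists n a, adm n a /\ f = \sum_(k < n) a k *: y k].
have [|C C0 AC] := @dual_uniform_bound R F A.
  move=> x; have /in_ellP[M yM] := ys (dual_eval x).
  exists (1 + M) => _ [n [a [[a0 aU] ->]]].
  rewrite (dual_sumE x (fun k => a k *: y k)).
  rewrite (le_trans (ler_norm_sum _ _ _))//.
  apply: (@le_trans _ _ (1 + \sum_(k < n) `|(y k x : R)| `^ p)); last first.
    by rewrite lerD2l; exact: yM.
  apply: le_trans (aU (fun k => `|(y k x : R)|) _); last by move=> k /=.
  apply: ler_sum => k _; rewrite -[X in _ <= X * _](ger0_norm (a0 k)) -normrM.
  exact: lexx.
pose t n : R := (vabs phi) (vabs (y n)).
have phi0 : vle 0 (vabs phi) := vabs_ge0 phi.
have pos0 (f : dual F) : vle 0 f -> 0 <= (vabs phi f : R).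
  by move=> f0; exact: (phi0 f f0).
have t0 n : 0 <= t n by apply: pos0; exact: vabs_ge0.
have tp : in_ell p t.
  apply: (@in_ell_dual R p t (`|vabs phi| * C)) => // n a a0 aU.
  have -> : \sum_(k < n) a k * t k =
      (vabs phi) (\sum_(k < n) a k *: vabs (y k)) :> R.
    rewrite linear_sum; apply: eq_bigr => k _; rewrite linearZ.
    by [].
  rewrite (le_trans (ler_norm _))// (le_trans (dual_op_normr _ _))//.
  rewrite ler_wpM2l// norm_sum_vabs//.
  by apply: AC; exists n, a.
apply: in_ell_le tp => [|n]; first exact: le_trans p1.
rewrite [leRHS]ger0_norm// (le_trans (dual_vabs _ _))//.
rewrite -subr_ge0 /t -linearB; apply: pos0.
by apply/vle_subr0; exact: zy.
Qed.

(** * The lattice seminorm *)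

Section seminorm.
Context {R : realType} {H : banachLatticeType R} {Y : completeNormedModType R}.
Variable S : bounded_op H Y.
Implicit Types x y : H.

Lemma lattice_seminorm_ge x y :
  vle (vabs y) (vabs x) -> `|S y| <= lattice_seminorm S x.
Proof.
move=> yx; apply: ub_le_sup; last by exists y.
exists (`|S| * `|x|) => _ [z /= zx <-].
by rewrite (le_trans (op_normr _ _))// ler_wpM2l//; exact: vle_norm.
Qed.

Lemma lattice_seminorm_ge0 x : 0 <= lattice_seminorm S x.
Proof.
apply: le_trans (normr_ge0 (S x)) _; apply: lattice_seminorm_ge.
exact: vle_refl.
Qed.

Lemma lattice_seminorm_vabs x :
  lattice_seminorm S (vabs x) = lattice_seminorm S x.
Proof. by rewrite /lattice_seminorm (vabs_id (vabs_ge0 x)). Qed.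

Lemma lattice_seminorm_near x : exists2 z, vle (vabs z) (vabs x) &
  lattice_seminorm S x <= 2 * `|S z|.
Proof.
set q := lattice_seminorm S x; have q0 : 0 <= q := lattice_seminorm_ge0 x.
have [q00|qn0] := eqVneq q 0.
  by exists x; [exact: vle_refl|rewrite q00 mulr_ge0].
have qlt : q / 2 < q.
  by rewrite ltr_pdivrMr// ltr_pMr ?ltr1n// lt_neqAle eq_sym qn0.
suff [z zx Sz] : exists2 z, vle (vabs z) (vabs x) & q / 2 < `|S z|.
  by exists z => //; rewrite mulrC -ler_pdivrMr// ltW.
apply: contrapT => N; move: qlt; rewrite ltNge => /negP; apply.
apply: ge_sup; first by exists `|S x|, x => //=; exact: vle_refl.
by move=> _ [z /= zx <-]; rewrite leNgt; apply/negP => Sz; apply: N; exists z.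
Qed.

End seminorm.

Lemma cvg0_le (R : realType) (c : R) (u v : nat -> R) :
  (forall n, `|u n| <= c * `|v n|) -> v n @[n --> \oo] --> (0 : R) ->
  u n @[n --> \oo] --> (0 : R).
Proof.
move=> uv v0; apply/norm_cvg0P.
have cv : c * `|v n| @[n --> \oo] --> (0 : R).
  by rewrite -[X in _ --> X](mulr0 c); apply: cvgMr; apply/norm_cvg0P.
by apply: (squeeze_cvgr _ (cvg_cst _) cv); near=> n; rewrite normr_ge0 uv.
Unshelve. all: by end_near. Qed.

(** * The space of absolutely summable sequences *)

Section ell1_lattice.
Context {R : realType}.
Implicit Types x y z : ell1 R.

Lemma ell1_cvg_abs x : cvgn (series (fun k => `|x k|)).
Proof.
have := ell1P x; rewrite /in_ell.
by under eq_fun do rewrite powRr1//.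
Qed.

Lemma ell1_abs_subproof x : in_ell 1 (fun k => `|x k|).
Proof. by apply: (@in_ell_le R 1 _ x _ _ (ell1P x)) => // k; rewrite normr_id. Qed.

Definition ell1_abs x := Ell1 (@ell1_abs_subproof x).
Definition ell1_le x y := forall k, x k <= y k.
(** These formulas for the coordinatewise maximum and minimum make
    summability follow from that of sums, multiples and absolute values. *)
Definition ell1_sup x y : ell1 R := 2^-1 *: (x + y + ell1_abs (x - y)).
Definition ell1_inf x y : ell1 R := 2^-1 *: (x + y - ell1_abs (x - y)).

Lemma ell1_supE x y k : ell1_sup x y k = Num.max (x k) (y k).
Proof.
rewrite /= -[LHS]/(2^-1 * (x k + y k + `|x k - y k|)).
by have [xy|xy] := leP (x k) (y k); [rewrite ler0_norm|rewrite gtr0_norm]; lra.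
Qed.

Lemma ell1_infE x y k : ell1_inf x y k = Num.min (x k) (y k).
Proof.
rewrite /= -[LHS]/(2^-1 * (x k + y k - `|x k - y k|)).
by have [xy|xy] := leP (x k) (y k); [rewrite ler0_norm|rewrite gtr0_norm]; lra.
Qed.

Lemma ell1_le_refl x : ell1_le x x. Proof. by move=> k. Qed.

Lemma ell1_le_anti x y : ell1_le x y -> ell1_le y x -> x = y.
Proof. by move=> xy yx; apply: ell1_ext => k; apply/le_anti/andP. Qed.

Lemma ell1_le_trans y x z : ell1_le x y -> ell1_le y z -> ell1_le x z.
Proof. by move=> xy yz k; exact: le_trans (yz k). Qed.

Lemma ell1_supP x y z : ell1_le (ell1_sup x y) z <-> ell1_le x z /\ ell1_le y z.
Proof.
split=> [H|[xz yz] k]; last by rewrite ell1_supE ge_max xz yz.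
by split=> k; have := H k; rewrite ell1_supE ge_max => /andP[].
Qed.

Lemma ell1_infP x y z : ell1_le z (ell1_inf x y) <-> ell1_le z x /\ ell1_le z y.
Proof.
split=> [H|[xz yz] k]; last by rewrite ell1_infE le_min xz yz.
by split=> k; have := H k; rewrite ell1_infE le_min => /andP[].
Qed.

Lemma ell1_le_add z x y : ell1_le x y -> ell1_le (x + z) (y + z).
Proof. by move=> xy k; exact: lerD (xy k) (lexx (z k)). Qed.

Lemma ell1_le_scale (a : R) x y :
  0 <= a -> ell1_le x y -> ell1_le (a *: x) (a *: y).
Proof. by move=> a0 xy k; exact: ler_wpM2l (xy k). Qed.

Lemma ell1_le_norm x y :
  ell1_le (ell1_sup x (- x)) (ell1_sup y (- y)) -> `|x| <= `|y|.
Proof.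
have absE z k : ell1_sup z (- z) k = `|z k|.
  by rewrite ell1_supE -[(- z) k]/(- z k) maxrN.
move=> xy; apply: ler_lim; try exact: ell1_cvg_abs.
by near=> n; apply: ler_sum => k _; rewrite -!absE.
Unshelve. all: by end_near. Qed.

HB.instance Definition _ := isBanachLattice.Build R (ell1 R)
  ell1_le_refl ell1_le_anti ell1_le_trans ell1_supP ell1_infP
  ell1_le_add ell1_le_scale ell1_le_norm.

Lemma sum_delta_le1 n m : \sum_(0 <= k < m) ((k == n)%:R : R) <= 1.
Proof.
have [nm|mn] := ltnP n m; last first.
  rewrite big_nat big1// => k km.
  by rewrite ltn_eqF//; apply: leq_trans mn.
rewrite (bigD1_seq n) ?iota_uniq ?mem_index_iota//= eqxx big1 ?addr0//.
by move=> k /negPf ->.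
Qed.

Lemma ell1_delta_subproof n : in_ell 1 (fun k => (k == n)%:R : R).
Proof.
apply/in_ellP; exists 1 => m; apply: le_trans (sum_delta_le1 n m).
rewrite big_mkord; apply: ler_sum => k _.
by rewrite powRr1// ger0_norm.
Qed.

Definition ell1_delta n : ell1 R := Ell1 (@ell1_delta_subproof n).

Lemma ell1_norm_delta n : `|ell1_delta n| <= 1.
Proof.
apply: limr_le; first exact: ell1_cvg_abs.
apply: nearW => m; apply: le_trans (sum_delta_le1 n m).
by apply: ler_sum => k _; rewrite ger0_norm.
Qed.

End ell1_lattice.

(** The universal property of [ell1]: a bounded sequence [x] in a Banach space
    determines the operator sending the [n]-th unit vector to [x n]. *)
Section ell1_lift.
Context {R : realType} {X : completeNormedModType R} (x : nat -> X) (M : R).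
Hypothesis xM : forall n, `|x n| <= M.

Let M0 : 0 <= M. Proof. exact: le_trans (xM 0). Qed.

Definition ell1_lift_fun (a : ell1 R) : X := limn (series (fun k => a k *: x k)).

Let normed_le (a : ell1 R) k : `|a k *: x k| <= (M *: (fun k => `|a k|)) k.
Proof. by rewrite normrZ mulrC; apply: ler_wpM2r. Qed.

Let dom_cvg (a : ell1 R) : cvgn (series (M *: (fun k => `|a k|))).
Proof. by apply: is_cvg_seriesZ; exact: ell1_cvg_abs. Qed.

Let normed_cvgn (a : ell1 R) : cvgn [normed series (fun k => a k *: x k)].
Proof.
apply: series_le_cvg (@normed_le a) (@dom_cvg a) => k; first exact: normr_ge0.
exact: mulr_ge0.
Qed.

Let lift_cvgn (a : ell1 R) : cvgn (series (fun k => a k *: x k)).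
Proof. exact: normed_cvg. Qed.

Lemma ell1_lift_linear : linear ell1_lift_fun.
Proof.
move=> c a b; rewrite /ell1_lift_fun.
have -> : (fun k => (c *: a + b : ell1 R) k *: x k) =
    c *: (fun k => a k *: x k) + (fun k => b k *: x k).
  by apply/funext => k; rewrite -[LHS]/((c * a k + b k) *: x k) scalerDl -scalerA.
rewrite seriesD seriesZ; apply: (cvg_lim (@norm_hausdorff _ _)).
by apply: cvgD; [apply: cvgZl_tmp|]; exact: lift_cvgn.
Qed.

HB.instance Definition _ :=
  GRing.isLinear.Build R (ell1 R) X _ ell1_lift_fun ell1_lift_linear.

Lemma ell1_lift_bounded : bounded_near ell1_lift_fun (nbhs (0 : ell1 R)).
Proof.
apply: (@bounded_near_linear _ _ _ _ M) => a.
apply: le_trans (lim_series_norm (@normed_cvgn a)) _.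
have -> : M * `|a| = limn (series (M *: (fun k => `|a k|))).
  by rewrite lim_seriesZ//; exact: ell1_cvg_abs.
apply: ler_lim => //; apply: nearW => n.
by apply: ler_sum => k _; exact: normed_le a k.
Qed.

Definition ell1_lift : bounded_op (ell1 R) X := BoundedOp ell1_lift_bounded.

Lemma ell1_lift_delta n : ell1_lift (ell1_delta n) = x n.
Proof.
apply: (cvg_lim (@norm_hausdorff _ _)); apply: cvg_near_cst.
near=> m; rewrite /series /= (bigD1_seq n) ?iota_uniq//=; last first.
  by rewrite mem_index_iota/=; near: m; exact: nbhs_infty_gt.
rewrite eqxx scale1r big1 ?addr0// => k /negPf ->.
by rewrite scale0r.
Unshelve. all: by end_near. Qed.

End ell1_lift.

(** * Disjoint [p]-convergent adjoints *)

Lemma bounded_fun_seq (R : realType) (X : normedModType R) (x : nat -> X) :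
  bounded_fun x <-> exists M, forall n, `|x n| <= M.
Proof.
have G : ProperFilter (globally [set: nat]) by exact: (@globally_properfilter _ _ 0).
split=> [/ex_bound[M xM]|[M xM]]; first by exists M => n; exact: xM.
by apply/ex_bound; exists M => n _; exact: xM.
Qed.

Theorem lemma3p2 (R : realType) (p : R) (hp : 1 <= p)
    (X : completeNormedModType R) (F : banachLatticeType R)
    (T : bounded_op X F) :
  [<->
    (* (a) *)
    disjoint_p_convergent p (adjoint T) ;
    (* (b) *)
    forall y : nat -> dual F, disjoint_seq y -> weakly_p_summable p y ->
      lattice_seminorm (adjoint T) (y n) @[n --> \oo] --> (0 : R) ;
    (* (c) *)
    forall y : nat -> dual F, (forall n, vle 0 (y n)) ->
      disjoint_seq y -> weakly_p_summable p y ->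
      lattice_seminorm (adjoint T) (y n) @[n --> \oo] --> (0 : R) ;
    (* (d) *)
    forall (y : nat -> dual F) (x : nat -> X),
      disjoint_seq y -> weakly_p_summable p y -> bounded_fun x ->
      (y n (T (x n)) : R) @[n --> \oo] --> (0 : R) ;
    (* (e) *)
    forall (y : nat -> dual F) (x : nat -> X), (forall n, vle 0 (y n)) ->
      disjoint_seq y -> weakly_p_summable p y -> bounded_fun x ->
      (y n (T (x n)) : R) @[n --> \oo] --> (0 : R) ;
    (* (f) *)
    forall (G : banachLatticeType R) (S : bounded_op G X),
      disjoint_p_convergent p (bounded_comp (adjoint S) (adjoint T)) ;
    (* (g) *)
    forall S : bounded_op (ell1 R) X,
      disjoint_p_convergent p (bounded_comp (adjoint S) (adjoint T))
  ].
Proof.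
tfae.
- move=> cT y yd ys.
  have /choice[z zP] n : exists z, vle (vabs z) (vabs (y n)) /\
      lattice_seminorm (adjoint T) (y n) <= 2 * `|adjoint T z|.
    by have [z] := lattice_seminorm_near (adjoint T) (y n); exists z.
  have zy n : vle (vabs (z n)) (vabs (y n)) by case: (zP n).
  have zs := disjoint_weakly_p_summable_le hp zy yd ys.
  apply: (cvg0_le (c := 2)) (cT z (disjoint_seq_le zy yd) zs) => n.
  rewrite ger0_norm ?lattice_seminorm_ge0// normr_id.
  by case: (zP n).
- by move=> b y _; exact: b.
- move=> c y x yd ys /bounded_fun_seq[M xM].
  pose w n := vabs (y n).
  have w0 n : vle 0 (w n) := vabs_ge0 (y n).
  have wy n : vle (vabs (w n)) (vabs (y n)).
    by rewrite (vabs_id (w0 n)); exact: vle_refl.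
  have ws := disjoint_weakly_p_summable_le hp wy yd ys.
  apply: (cvg0_le (c := M)) (c w w0 (disjoint_seq_le wy yd) ws) => n.
  rewrite lattice_seminorm_vabs [X in _ * X]ger0_norm ?lattice_seminorm_ge0//.
  apply: le_trans (dual_op_normr (adjoint T (y n)) (x n)) _; rewrite mulrC.
  apply: ler_pM (xM n) _ => //; apply: lattice_seminorm_ge; exact: vle_refl.
- by move=> d y x _; exact: d.
- move=> e G S y yd ys.
  (* A positive sequence below [|y n|] is tested along the images under [S] of
     vectors of the unit ball of [G] that norm it up to a factor 2. *)
  have pos z : (forall n, vle 0 (z n)) -> (forall n, vle (z n) (vabs (y n))) ->
      (`|adjoint S (adjoint T (z n))| : R) @[n --> \oo] --> (0 : R).
    move=> z0 zy'.
    have zy n : vle (vabs (z n)) (vabs (y n)) by rewrite vabs_id.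
    have zs := disjoint_weakly_p_summable_le hp zy yd ys.
    have /choice[g gP] n : exists g : G, `|g| <= 1 /\
        `|adjoint S (adjoint T (z n))| <= 2 * `|(z n (T (S g)) : R)|.
      by have [g] := dual_near_norming (adjoint S (adjoint T (z n))); exists g.
    have Sg : bounded_fun (fun n => S (g n)).
      apply/bounded_fun_seq; exists `|S| => n.
      rewrite (le_trans (op_normr _ _))// -[leRHS]mulr1 ler_wpM2l//.
      by case: (gP n).
    apply: (cvg0_le (c := 2)) (e z _ z0 (disjoint_seq_le zy yd) zs Sg) => n.
    by rewrite normr_id; case: (gP n).
  have /choice[a aP] n := vdecomp_vabs (y n).
  have /choice[b bP] n := aP n.
  have a_cvg : (`|adjoint S (adjoint T (a n))| : R) @[n --> \oo] --> (0 : R).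
    by apply: pos => n; case: (bP n) => -[].
  have b_cvg : (`|adjoint S (adjoint T (b n))| : R) @[n --> \oo] --> (0 : R).
    by apply: pos => n; case: (bP n) => _ [].
  have ab : (`|adjoint S (adjoint T (a n))| + `|adjoint S (adjoint T (b n))| : R)
      @[n --> \oo] --> (0 : R).
    by rewrite -[X in _ --> X]addr0; exact: cvgD.
  apply: (cvg0_le (c := 1) _ ab) => n.
  rewrite normr_id mul1r [leRHS]ger0_norm ?addr_ge0//.
  have [_ _ ->] := bP n.
  rewrite -[X in `|X| <= _]/(adjoint S (adjoint T (a n - b n))) !linearB.
  exact: ler_normB.
- by move=> f S; exact: (f (ell1 R) S).
(* The operator [ell1_lift x1] carries the unit vectors to the near-norming
   vectors [x n], so that its adjoint sees at least half the norm. *)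
- move=> g y yd ys.
  have /choice[x xP] n : exists x : X, `|x| <= 1 /\
      `|adjoint T (y n)| <= 2 * `|(y n (T x) : R)|.
    by have [x] := dual_near_norming (adjoint T (y n)); exists x.
  have x1 n : `|x n| <= 1 by case: (xP n).
  apply: (cvg0_le (c := 2)) (g (ell1_lift x1) y yd ys) => n.
  rewrite !normr_id; have [_ xn] := xP n; rewrite (le_trans xn)// ler_wpM2l//.
  rewrite -(ell1_lift_delta x1 n).
  set S := ell1_lift x1.
  apply: le_trans (dual_op_normr (adjoint S (adjoint T (y n))) (ell1_delta n)) _.
  rewrite -[leRHS]mulr1 ler_wpM2l//.
  exact: ell1_norm_delta.
Qed.
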